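(* Let $p$ be a prime number. Let $s,n,L\ge 1$ be integers with $L\le s$, let $k\in\{1,\dots,n\}$, let $\alpha_1,\dots,\alpha_n\in\mathbb{F}_p$ be pairwise distinct, and put $R=\frac{k}{sn}$. Then the univariate multiplicity code $\mathsf{MULT}_{n,k}^{(s)}(\alpha_1,\dots,\alpha_n)$ over the alphabet $\mathbb{F}_p^s$ is $\left(\frac{L}{L+1}\left(1-\frac{sR}{s-L+1}\right),L\right)$ list-decodable. The same holds with list-decodability replaced by average-radius list-decodability.
   Context: Hasse derivatives: for a polynomial $f(X)$ over a field, the $i$-th Hasse derivative $f^{(i)}(X)$ is the coefficient of $Z^i$ in the expansion $f(X+Z)=\sum_{i\ge0}f^{(i)}(X)Z^i$. Univariate multiplicity code of order $s$: $\mathsf{MULT}_{n,k}^{(s)}(\alpha_1,\dots,\alpha_n)=\{\mathcal{M}(f): f\in\mathbb{F}_p[x],\ \deg f<k\}\subseteq(\mathbb{F}_p^s)^n$, where $\mathcal{M}(f)=(F_1,\dots,F_n)$ and $F_i=(f(\alpha_i),f^{(1)}(\alpha_i),\dots,f^{(s-1)}(\alpha_i))\in\mathbb{F}_p^s$. Its rate is $R=\frac{k}{sn}$. List-decodability: for $x,y\in\Sigma^n$ let $\delta(x,y)$ be the fraction of coordinates in which $x$ and $y$ differ. A code $C\subseteq\Sigma^n$ is $(\rho,L)$ list-decodable if for every $y\in\Sigma^n$ there are at most $L$ codewords $c\in C$ with $\delta(c,y)\le\rho$. It is $(\rho,L)$ average-radius list-decodable if there do not exist $y\in\Sigma^n$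 and pairwise distinct $x_1,\dots,x_{L+1}\in C$ with $\frac{1}{L+1}\sum_{i=1}^{L+1}\delta(x_i,y)\le\rho$. *)

(* Defs.v *)
From mathcomp Require Import all_boot all_order all_algebra.

Set Implicit Arguments.
Unset Strict Implicit.
Unset Printing Implicit Defensive.

Import Order.TTheory GRing.Theory Num.Theory.
Local Open Scope ring_scope.

(* [poly_XaY f] is the bivariate polynomial f(X + Z); the outer variable of
   {poly {poly F}} plays the role of Z and the inner one the role of X. *)
Definition hasse (F : fieldType) (i : nat) (f : {poly F}) : {poly F} :=
  (poly_XaY f)`_i.

Lemma hasseE (F : fieldType) (i : nat) (f : {poly F}) : hasse i f = f^`N(i).
Proof.
have XaYE : poly_XaY f = \poly_(j < size f) f^`N(j).
  rewrite poly_def /poly_XaY /comp_poly addrC nderiv_taylor; last exact: mulrC.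
  rewrite !size_map_polyC; apply: eq_bigr => j _.
  rewrite !nderivn_map horner_map /= -/(comp_poly _ _) comp_polyXr.
  by rewrite mul_polyC.
rewrite /hasse XaYE coef_poly; case: ltnP => // le_f_i.
by rewrite nderivn_poly0.
Qed.

Section Codes.
Variables (n : nat) (Sigma : finType).
Local Notation word := {ffun 'I_n -> Sigma}.

Definition delta (x y : word) : rat := #|[set i | x i != y i]|%:R / n%:R.

Definition list_decodable (rho : rat) (L : nat) (C : {set word}) : Prop :=
  forall y : word, (#|[set c in C | (delta c y <= rho)%R]| <= L)%N.

Definition avg_radius_list_decodable
    (rho : rat) (L : nat) (C : {set word}) : Prop :=
  ~ exists (y : word) (x : 'I_L.+1 -> word),
      [/\ injective x, forall i, x i \in C
        & (\sum_i delta (x i) y) / L.+1%:R <= rho].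

End Codes.

Definition mult_encode (F : finFieldType) (n s : nat) (alpha : 'I_n -> F)
    (f : {poly F}) : {ffun 'I_n -> 'rV[F]_s} :=
  [ffun i => \row_(j < s) (hasse j f).[alpha i]].

(* {poly_k F} is the type of polynomials of size at most k, i.e. deg f < k. *)
Definition mult_code (F : finFieldType) (n k s : nat) (alpha : 'I_n -> F) :
    {set {ffun 'I_n -> 'rV[F]_s}} :=
  [set mult_encode s alpha (val f) | f in [set: {poly_k F}]].

Lemma mult_codeP (F : finFieldType) (n k s : nat) (alpha : 'I_n -> F)
    (c : {ffun 'I_n -> 'rV[F]_s}) :
  reflect (exists2 f : {poly F}, (size f <= k)%N & c = mult_encode s alpha f)
          (c \in mult_code k s alpha).
Proof.
apply: (iffP imsetP) => [[f _ ->]|[f fk ->]].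
  by exists (val f) => //; apply: size_npoly.
by exists (NPoly fk) => //; rewrite inE.
Qed.

Definition mult_rate (n k s : nat) : rat := k%:R / (s%:R * n%:R).

(* Main.v *)
Require Import Defs.
From mathcomp Require Import all_boot all_order all_algebra.
From mathcomp Require Import perm lra ring zify.

Set Implicit Arguments.
Unset Strict Implicit.
Unset Printing Implicit Defensive.

Import Order.TTheory GRing.Theory Num.Theory.
Local Open Scope ring_scope.

(* Let f_0, ..., f_L be distinct polynomials of degree < k, let e_j be the set
   of those agreeing with the received word at the j-th position, and let W_j
   be the space of polynomials of degree < k vanishing to order s at alpha_j;
   differences of members of e_j lie in W_j.

   (1) For a space U of dimension d <= s, the Wronskian of U is a nonzero
   polynomial of degree at most d(k-1), divisible by (X - alpha_j) to the power
   (s-d+1) dim(W_j :&: U). With tau = (k-1)/(s-L+1) this gives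
   sum_j dim(W_j :&: U) <= tau dim U for every U of dimension at most L.

   (2) These inequalities imply sum_j (#|e_j| - 1) <= tau L, even when the f_i
   are affinely dependent. Attach weights x_j >= 0 to the flats. If some proper
   subspace U is tight, split the points into classes modulo U and induct on U
   and on the quotient by U. Otherwise move weight between two flats, keeping
   the load of the whole space and not decreasing the objective, until a proper
   subspace becomes tight or a weight vanishes; with a single flat left the
   bound is immediate.

   Since tau < k/(s-L+1), the total distance of the f_i to the received word
   then exceeds the average-radius bound. *)

(** Each nonempty fiber on [A] gives one image point plus its size minus one; fibers of [S] missing
    [A] add nothing, as [0.-1 = 0]. *)
Lemma card_pred_fibers (T : finType) (rep : T -> T) (A S : {set T}) :
  A \subset S ->
  (#|A|.-1 = #|rep @: A|.-1
             + \sum_(c in rep @: S) #|A :&: rep @^-1: [set c]|.-1)%N.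
Proof.
move=> sAS; have [->|[a aA]] := set_0Vmem A.
  by rewrite imset0 cards0 big1 // => c _; rewrite set0I cards0.
have eqA : #|A| = (\sum_(c in rep @: A) #|A :&: rep @^-1: [set c]|)%N.
  rewrite -sum1_card (partition_big_imset rep) /=; apply: eq_bigr => c _.
  by rewrite -sum1_card; apply: eq_bigl => i; rewrite !inE.
have pos c : c \in rep @: A -> (0 < #|A :&: rep @^-1: [set c]|)%N.
  case/imsetP => i iA ->; apply/card_gt0P; exists i.
  by rewrite !inE iA eqxx.
have {}eqA : #|A| = (#|rep @: A|
    + \sum_(c in rep @: A) #|A :&: rep @^-1: [set c]|.-1)%N.
  rewrite eqA -[X in (X + _)%N]sum1_card -big_split /=.
  by apply: eq_bigr => c cA; rewrite add1n prednK // pos.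
have -> : (\sum_(c in rep @: S) #|A :&: rep @^-1: [set c]|.-1
   = \sum_(c in rep @: A) #|A :&: rep @^-1: [set c]|.-1)%N.
  rewrite (big_setID (rep @: A)) /= (setIidPr _) ?imsetS //.
  rewrite [X in (_ + X)%N]big1 ?addn0 // => c; rewrite inE => /andP[cA _].
  have -> : A :&: rep @^-1: [set c] = set0; last by rewrite cards0.
  apply/setP => i; rewrite !inE; apply/negP => /andP[iA /eqP ric].
  by case/negP: cA; rewrite -ric imset_f.
have : (0 < #|rep @: A|)%N by apply/card_gt0P; exists (rep a); apply: imset_f.
by rewrite {1}eqA; case: #|rep @: A|.
Qed.

(** * Weighted affine flats under rank inequalities *)

Section Flats.
Variables (F : finFieldType) (N : nat) (R : realFieldType) (J T : finType).
Variables (f : T -> 'rV[F]_N) (tau : R).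

Implicit Types (A B U V : 'M[F]_N) (S : {set T}) (e : J -> {set T}).
Implicit Types (W : J -> 'M[F]_N) (x : J -> R).

(** For [B] inside [A] and [V], the dimension of [(A :&: V) / B], in [R] so that subtraction is not
    truncated. *)
Definition excess B V A : R := (\rank (A :&: V)%MS)%:R - (\rank B)%:R.

(* A weighted family of affine flats in the quotient space V / B: the [j]-th
   flat has direction [W j] and meets the point set [f @: S] in [f @: e j]. *)
Record flat_config B V S e W x : Prop := FlatConfig {
  fc_BV : (B <= V)%MS;
  fc_x : forall j, 0 <= x j;
  fc_S : {in S &, forall a b, a != b -> ~~ (f a - f b <= B)%MS};
  fc_V : {in S &, forall a b, (f a - f b <= V)%MS};
  fc_e : forall j, e j \subset S;
  fc_BW : forall j, (B <= W j)%MS;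
  fc_W : forall j, {in e j &, forall a b, (f a - f b <= W j)%MS};
  fc_le : forall U, (B <= U)%MS -> (U <= V)%MS ->
    \sum_j x j * excess B U (W j) <= tau * ((\rank U)%:R - (\rank B)%:R) }.

Definition flat_bound S e x :=
  \sum_j x j * #|e j|.-1%:R <= tau * #|S|.-1%:R.

(** Makes the classes modulo [U] fibers of a map. For [a] in [S] the default is never reached. *)
Definition class_rep S U a := odflt a [pick b in S | (f a - f b <= U)%MS].

Lemma class_repP S U a : a \in S ->
  class_rep S U a \in S /\ (f a - f (class_rep S U a) <= U)%MS.
Proof.
move=> aS; rewrite /class_rep; case: pickP => [b /andP[]|/(_ a)] //=.
by rewrite aS subrr sub0mx.
Qed.

Lemma sub_diff_sym U a b : (f a - f b <= U)%MS = (f b - f a <= U)%MS.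
Proof. by rewrite -opprB eqmx_opp. Qed.

Lemma sub_diff_trans U a b c :
  (f a - f b <= U)%MS -> (f b - f c <= U)%MS -> (f a - f c <= U)%MS.
Proof.
by move=> ab bc; rewrite -(subrK (f b) (f a)) -addrA addmx_sub.
Qed.

Lemma class_rep_eq S U a b : a \in S -> b \in S ->
  (class_rep S U a == class_rep S U b) = (f a - f b <= U)%MS.
Proof.
move=> aS bS; have [_ ra] := class_repP U aS; have [_ rb] := class_repP U bS.
apply/eqP/idP => [E|ab].
  by rewrite E in ra; apply: sub_diff_trans ra _; rewrite sub_diff_sym.
rewrite /class_rep.
have E : [pred c | (c \in S) && (f a - f c <= U)%MS]
   =1 [pred c | (c \in S) && (f b - f c <= U)%MS].
  move=> c /=; congr (_ && _); apply/idP/idP; apply: sub_diff_trans => //.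
  by rewrite sub_diff_sym.
rewrite (eq_pick E); case: pickP => // /(_ b) /=.
by rewrite bS subrr sub0mx.
Qed.

Lemma excess_ge0 B U A : (B <= U)%MS -> (B <= A)%MS -> 0 <= excess B U A.
Proof.
by move=> BU BA; rewrite /excess subr_ge0 ler_nat mxrankS // sub_capmx BA.
Qed.

Lemma excessS B U V A : (U <= V)%MS -> excess B U A <= excess B V A.
Proof.
by move=> UV; rewrite /excess lerD2r ler_nat mxrankS // capmxS.
Qed.

(** The modular law and the dimension formula; this makes the excess additive along
    [B <= U <= V]. *)
Lemma excess_quotient U V A : (U <= V)%MS ->
  excess U V (A + U)%MS = (\rank (A :&: V)%MS)%:R - (\rank (A :&: U)%MS)%:R.
Proof.
move=> UV; rewrite /excess.
have -> : \rank ((A + U) :&: V)%MS = \rank (U + (A :&: V))%MS.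
  by rewrite [(A + U)%MS]addsmxC (matrix_modl A UV).
have := mxrank_sum_cap U (A :&: V)%MS.
have -> : \rank (U :&: (A :&: V))%MS = \rank (A :&: U)%MS.
  apply: eqmx_rank; rewrite !sub_capmx capmxSl !capmxSr.
  rewrite !(submx_trans _ UV) ?capmxSr ?capmxSl //=.
  by rewrite andbT (submx_trans (capmxSr _ _)) ?capmxSl.
move/(congr1 (fun n => n%:R : R)); rewrite !natrD => /eqP.
by rewrite -subr_eq => /eqP <-; lra.
Qed.

(** Each class modulo [U] is a configuration in [U / B]. The representatives form one in [V / U],
    where the inequality at [U'] results from subtracting the equality at [U]. The bounds add up
    over fibers. *)
Lemma flat_bound_split B U V S e W x :
  (forall S' e', flat_config B U S' e' W x -> flat_bound S' e' x) ->
  (forall S' e' W', flat_config U V S' e' W' x -> flat_bound S' e' x) ->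
  flat_config B V S e W x -> (B <= U)%MS -> (U <= V)%MS ->
  \sum_j x j * excess B U (W j) = tau * ((\rank U)%:R - (\rank B)%:R) ->
  flat_bound S e x.
Proof.
move=> boundU boundV [BV x0 Sinj SV eS BW eW le] BU UV tight.
pose rep := class_rep S U.
have repS a : a \in S -> rep a \in S by move=> /(class_repP U)[].
have inS j a : a \in e j -> a \in S by apply: (subsetP (eS j)).
have bound1 c : flat_bound (S :&: rep @^-1: [set c])
                           (fun j => e j :&: rep @^-1: [set c]) x.
  apply: boundU; split=> //.
  - by move=> a b; rewrite !inE => /andP[aS _] /andP[bS _]; apply: Sinj.
  - move=> a b; rewrite !inE => /andP[aS /eqP ra] /andP[bS /eqP rb].
    by rewrite -(@class_rep_eq S) // -/rep -/(rep b) ra rb.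
  - by move=> j; apply: setSI.
  - by move=> j a b; rewrite !inE => /andP[aS _] /andP[bS _]; apply: eW.
  - by move=> U' BU' U'U; apply: le => //; apply: submx_trans UV.
have bound2 : flat_bound (rep @: S) (fun j => rep @: e j) x.
  apply: (boundV _ _ (fun j => (W j + U)%MS)); split=> //.
  - move=> _ _ /imsetP[a aS ->] /imsetP[b bS ->].
    apply: contraNN; rewrite -(@class_rep_eq S) ?repS //.
    have idem c : c \in S -> class_rep S U (rep c) = rep c.
      move=> cS; apply/eqP; rewrite class_rep_eq ?repS //.
      by rewrite sub_diff_sym; case: (class_repP U cS).
    by rewrite !idem.
  - by move=> _ _ /imsetP[a aS ->] /imsetP[b bS ->]; apply: SV; apply: repS.
  - by move=> j; apply: imsetS.
  - by move=> j; apply: addsmxSr.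
  - move=> j _ _ /imsetP[a ae ->] /imsetP[b be ->].
    have [_ ra] := class_repP U (inS _ _ ae).
    have [_ rb] := class_repP U (inS _ _ be).
    apply: (@sub_diff_trans _ _ a).
      by rewrite sub_diff_sym (submx_trans ra) // addsmxSr.
    apply: (@sub_diff_trans _ _ b).
      by rewrite (submx_trans (eW _ _ _ ae be)) // addsmxSl.
    by rewrite (submx_trans rb) // addsmxSr.
  - move=> U' UU' U'V; have := le _ (submx_trans BU UU') U'V.
    have -> : \sum_j x j * excess B U' (W j) =
       \sum_j x j * excess U U' (W j + U)%MS + \sum_j x j * excess B U (W j).
      rewrite -big_split /=; apply: eq_bigr => j _.
      by rewrite excess_quotient // -mulrDr /excess; congr (_ * _); lra.
    by rewrite tight; lra.
rewrite /flat_bound (card_pred_fibers rep (subxx S)).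
have -> : \sum_j x j * #|e j|.-1%:R = \sum_j x j * #|rep @: e j|.-1%:R +
    \sum_(c in rep @: S) \sum_j x j * #|e j :&: rep @^-1: [set c]|.-1%:R.
  rewrite exchange_big -big_split /=; apply: eq_bigr => j _.
  by rewrite (card_pred_fibers rep (eS j)) natrD mulrDr natr_sum mulr_sumr.
rewrite natrD mulrDr natr_sum mulr_sumr lerD //.
by apply: ler_sum => c _; apply: bound1.
Qed.


(** Differences within [e j] lie in [W j :&: V], hence in [B], while points of [S] are distinct
    modulo [B]. *)
Lemma flat_config_card1 B V S e W x j :
  flat_config B V S e W x -> excess B V (W j) = 0 -> #|e j|.-1 = 0%N.
Proof.
move=> [BV x0 Sinj SV eS BW eW le] /eqP.
rewrite /excess subr_eq0 eqr_nat => /eqP rk.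
have WB : (W j :&: V <= B)%MS.
  have BWV : (B <= W j :&: V)%MS by rewrite sub_capmx BW.
  by rewrite -(mxrank_leqif_sup BWV).2 rk.
apply/eqP; rewrite -subn1 subn_eq0; apply/card_le1_eqP => a b ae be.
apply/eqP; apply: contraT; rewrite eq_sym => ab.
have aS := subsetP (eS j) _ ae; have bS := subsetP (eS j) _ be.
have /negP[] := Sinj _ _ aS bS ab.
by apply: submx_trans WB; rewrite sub_capmx eW ?SV.
Qed.

(** Test the inequality at [W j :&: V], whose dimension over [B] is the excess of [W j]; the other
    terms are nonnegative. *)
Lemma flat_config_le B V S e W x j :
  flat_config B V S e W x -> 0 < excess B V (W j) -> x j <= tau.
Proof.
move=> [BV x0 Sinj SV eS BW eW le] pos.
have BU : (B <= W j :&: V)%MS by rewrite sub_capmx BW.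
have := le _ BU (capmxSr _ _).
rewrite (bigD1 j) //= => H.
have E : excess B (W j :&: V)%MS (W j) = excess B V (W j).
  rewrite /excess; congr (_%:R - _); apply: eqmx_rank.
  by rewrite capmxSr sub_capmx capmxSl submx_refl.
rewrite -(ler_pM2r pos) -{1}E; apply: le_trans H; rewrite lerDl.
by apply: sumr_ge0 => i _; rewrite mulr_ge0 // excess_ge0.
Qed.

Lemma sum_shift (a b : J) (u v : R) (x g : J -> R) :
  \sum_j (x j + u * (j == a)%:R - v * (j == b)%:R) * g j
  = \sum_j x j * g j + u * g a - v * g b.
Proof.
under eq_bigr => j _ do rewrite mulrBl mulrDl.
rewrite sumrB big_split /=; congr (_ + _ - _).
  rewrite (bigD1 a) //= eqxx mulr1 big1 ?addr0 // => j /negPf ->.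
  by rewrite mulr0 mul0r.
rewrite (bigD1 b) //= eqxx mulr1 big1 ?addr0 // => j /negPf ->.
by rewrite mulr0 mul0r.
Qed.

(** Induction on [\rank V - \rank B], then on the number of flats with nonzero weight and positive
    excess. *)
Theorem flat_config_bound B V S e W x :
  0 <= tau -> flat_config B V S e W x -> flat_bound S e x.
Proof.
move=> tau0; have [d] := ubnP (\rank V - \rank B)%N.
elim: d B V S e W x => // d IHd B V S e W x ltd cfg.
pose supp (y : J -> R) := [set j | (y j != 0) && (0 < excess B V (W j))].
have [m] := ubnP #|supp x|; elim: m x cfg => // m IHm x cfg ltm.
have [BV x0 Sinj SV eS BW eW le] := cfg.
have ex0 U j : (B <= U)%MS -> 0 <= excess B U (W j).
  by move=> BU; apply: excess_ge0.
have [/card_le1_eqP le1|] := leqP #|supp x| 1.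
  have zero j : j \notin supp x -> x j * #|e j|.-1%:R = 0.
    rewrite inE negb_and negbK -leNgt => /orP[/eqP->|ej]; first exact: mul0r.
    rewrite (flat_config_card1 cfg) ?mulr0 //.
    by apply/le_anti; rewrite ej ex0.
  rewrite /flat_bound; have [s0|[a aP]] := set_0Vmem (supp x).
    by rewrite big1 ?mulr_ge0 // => j _; apply: zero; rewrite s0 inE.
  rewrite (bigD1 a) //= big1 => [|j ja]; last first.
    apply: zero; apply: contra ja => jP; apply/eqP; exact: le1.
  have := aP; rewrite inE addr0 => /andP[_ pa].
  rewrite ler_pM ?(flat_config_le cfg pa) // ler_nat.
  have := subset_leq_card (eS a); lia.
case/card_gt1P => a0 [b0 [aP0 bP0 ab0]].
(* Order the two flats so that the exchange below cannot decrease the objective. *)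
have [a [b [aP bP ab obj]]] : exists a b, [/\ a \in supp x, b \in supp x, a != b
    & excess B V (W a) * #|e b|.-1%:R <= excess B V (W b) * #|e a|.-1%:R].
  have [le1|/ltW le1] :=
    leP (excess B V (W a0) * #|e b0|.-1%:R) (excess B V (W b0) * #|e a0|.-1%:R).
    by exists a0, b0.
  by exists b0, a0; split=> //; rewrite eq_sym.
move: (aP) (bP); rewrite !inE => /andP[xa pa] /andP[xb pb].
pose ha := excess B V (W a); pose hb := excess B V (W b).
(* These rates keep the load of [V] constant. The load of [U] changes at rate [beta U], and [b] runs
   out of weight at [tmax]. *)
pose y t j := x j + t * hb * (j == a)%:R - t * ha * (j == b)%:R.
pose beta U := hb * excess B U (W a) - ha * excess B U (W b).
pose load U (z : J -> R) := \sum_j z j * excess B U (W j).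
pose cap U : R := tau * ((\rank U)%:R - (\rank B)%:R).
have loadE U t : load U (y t) = load U x + t * beta U.
  by rewrite /load sum_shift /beta; lra.
pose tmax := x b / ha.
have tmax0 : 0 <= tmax by rewrite divr_ge0 // ltW.
have cfgy t : 0 <= t -> t <= tmax ->
    (forall U, (B <= U)%MS -> (U <= V)%MS -> load U (y t) <= cap U) ->
    flat_config B V S e W (y t).
  move=> t0 tT H; split=> // j; rewrite /y.
  have [->|_] := eqVneq j b.
    have := ab; rewrite eq_sym => /negPf ->.
    rewrite mulr0 addr0 mulr1 subr_ge0 -ler_pdivlMr //.
  by rewrite mulr0 subr0 addr_ge0 // !mulr_ge0 // ltW.
have boundy t : 0 <= t -> flat_bound S e (y t) -> flat_bound S e x.
  move=> t0; apply: le_trans; rewrite sum_shift -addrA lerDl.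
  by rewrite -!mulrA -mulrBr mulr_ge0 // subr_ge0.
(* If nothing is overloaded at [tmax], move there: [b] leaves the support. *)
pose bad U := [&& (B <= U)%MS, (U <= V)%MS & cap U < load U (y tmax)].
have [U0 badU0|good] := pickP bad; last first.
  apply: (boundy tmax) => //; apply: IHm.
    apply: cfgy => // U BU UV; rewrite leNgt.
    by have := good U; rewrite /bad BU UV /= => ->.
  rewrite ltnS in ltm; apply: leq_trans ltm; apply: proper_card.
  apply/properP; split.
    apply/subsetP => j; rewrite !inE /y => /andP[yj ->]; rewrite andbT.
    have [->//|ja] := eqVneq j a; have [->//|jb] := eqVneq j b.
    move: yj; rewrite (negPf ja) (negPf jb) !mulr0 addr0 subr0.
    by [].
  exists b => //; rewrite inE /y eqxx.
  have := ab; rewrite eq_sym => /negPf ->.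
  rewrite mulr0 addr0 mulr1 /tmax divfK ?subrr ?eqxx //.
  by rewrite gt_eqF.
(* Otherwise stop when the first growing load meets its capacity; matrices over the finite [F] are
   finitely many, so a minimum exists. *)
pose crit U := [&& (B <= U)%MS, (U <= V)%MS & 0 < beta U].
pose ratio U := (cap U - load U x) / beta U.
have critU0 : crit U0 /\ ratio U0 < tmax.
  case/and3P: badU0 => BU UV; rewrite loadE => lt0.
  have lt1 : cap U0 - load U0 x < tmax * beta U0 by lra.
  have s0 : 0 <= cap U0 - load U0 x by rewrite subr_ge0; apply: le.
  have b0' : 0 < beta U0.
    rewrite ltNge; apply/negP => bneg.
    by have := mulr_ge0_le0 tmax0 bneg; lra.
  by rewrite /crit BU UV b0' /ratio ltr_pdivrMr.
case: critU0 => critU0 ltU0.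
case: (arg_minP ratio critU0) => U /and3P[BU UV bU] minU.
have s0 : 0 <= cap U - load U x by rewrite subr_ge0; apply: le.
have t0 : 0 <= ratio U by rewrite divr_ge0 // ltW.
have tT : ratio U <= tmax by apply: le_trans (ltW ltU0); apply: minU.
have cfgt : flat_config B V S e W (y (ratio U)).
  apply: cfgy => // U' BU' UV'; rewrite loadE.
  have s' : 0 <= cap U' - load U' x by rewrite subr_ge0; apply: le.
  have [bU'|bU'] := ltP 0 (beta U').
    have : ratio U <= ratio U' by apply: minU; rewrite /crit BU' UV'.
    by rewrite {2}/ratio ler_pdivlMr //; lra.
  by have := mulr_ge0_le0 t0 bU'; lra.
apply: (boundy (ratio U)) => //.
(* [beta] vanishes at [B] and at [V], so [U] lies strictly between. *)
have rBU : (\rank B < \rank U)%N.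
  rewrite ltn_neqAle mxrankS // andbT; apply/negP => /eqP E.
  have UB : (U <= B)%MS by rewrite -(mxrank_leqif_sup BU).2 E.
  have z j : excess B U (W j) = 0.
    apply/le_anti; rewrite ex0 // andbT /excess subr_le0 ler_nat mxrankS //.
    by apply: submx_trans UB; apply: capmxSr.
  by move: bU; rewrite /beta !z !mulr0 subr0 ltxx.
have rUV : (\rank U < \rank V)%N.
  rewrite ltn_neqAle mxrankS // andbT; apply/negP => /eqP E.
  have VU : (V <= U)%MS by rewrite -(mxrank_leqif_sup UV).2 E.
  have z j : excess B U (W j) = excess B V (W j).
    by apply/le_anti; rewrite !excessS.
  by move: bU; rewrite /beta !z mulrC subrr ltxx.
apply: (flat_bound_split _ _ cfgt BU UV).
- move=> S' e'; apply: IHd; move: ltd rBU rUV; clear; lia.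
- move=> S' e' W'; apply: IHd; move: ltd rBU rUV; clear; lia.
- rewrite -/(load U _) loadE /ratio divfK ?gt_eqF // -/(cap U); lra.
Qed.

End Flats.

(** * Wronskians for the Euler operator *)

Section Wronskian.
Variable F : fieldType.
Implicit Types (f g : {poly F}) (a : F).

(* With the Euler operator X d/dX in place of the derivative, X^n is an
   eigenvector, so the Wronskian of monomials is a Vandermonde determinant. *)
Definition euler f := 'X * f^`().

Lemma coef_euler_iter i f n : (iter i euler f)`_n = f`_n * n%:R ^+ i.
Proof.
elim: i => [|i IHi] /=; first by rewrite mulr1.
rewrite /euler coefXM coef_deriv; case: n IHi => [|n] IHi /=.
  by rewrite expr0n mulr0.
by rewrite IHi -[LHS]mulr_natr exprSr mulrA.
Qed.

Lemma size_euler_iter i f : (size (iter i euler f) <= size f)%N.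
Proof.
by apply/leq_sizeP => n nf; rewrite coef_euler_iter nth_default ?mul0r.
Qed.

Lemma dvdp_euler_iter a m i f :
  ('X - a%:P) ^+ (m + i) %| f -> ('X - a%:P) ^+ m %| iter i euler f.
Proof.
elim: i m => [|i IHi] m; first by rewrite addn0.
rewrite addnS -addSn => /IHi /dvdpP[q /= ->].
rewrite /euler derivM deriv_exp derivXsubC mul1r /=; apply: dvdp_mull.
apply: dvdp_add; first by apply: dvdp_mull; rewrite dvdp_exp2l.
by apply: dvdp_mull; rewrite -mulr_natr dvdp_mulr.
Qed.

(** Rows of [A] are coefficient vectors, column [i] holds [i]-th Euler iterates; the product form
    lets row operations on [A] factor out. *)
Definition wronskian k m d (A : 'M[F]_(m, k)) : 'M[{poly F}]_(m, d) :=
  map_mx polyC A *m \matrix_(n < k, i < d) ((n%:R ^+ i)%:P * 'X^n).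

Lemma wronskianE k m d (A : 'M[F]_(m, k)) b (i : 'I_d) :
  wronskian d A b i = iter i euler (rVpoly (row b A)).
Proof.
apply/polyP => n; rewrite coef_euler_iter coef_rVpoly mxE coef_sum.
transitivity (\sum_(j < k) A b j * (n%:R ^+ i) * (n == j)%:R).
  apply: eq_bigr => j _; rewrite !mxE -mulrA coefCM coefCM coefXn.
  by case: eqP => [->|]; rewrite ?mulr1 ?mulr0 // mulrA.
case: insubP => [j _ <-|nk].
  rewrite (bigD1 j) //= eqxx mulr1 big1 ?addr0 ?mxE // => j' ne.
  by rewrite [_ == _](negPf _) ?mulr0 // eq_sym.
rewrite mul0r big1 // => j _; rewrite [_ == _](negPf _) ?mulr0 //.
by apply: contra nk => /eqP ->.
Qed.

Lemma size_det_leq d k (M : 'M[{poly F}]_d) :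
  (forall i j, (size (M i j) <= k.+1)%N) -> (size (\det M) <= (d * k).+1)%N.
Proof.
move=> szM; rewrite /determinant (leq_trans (size_sum _ _ _)) //.
apply/bigmax_leqP => s _; rewrite size_Msign.
rewrite (leq_trans (size_poly_prod_leq _ _)) //.
have : (\sum_(i < d) size (M i (s i)) <= d * k.+1)%N.
  by rewrite -[X in (_ <= X * _)%N]card_ord -sum_nat_const leq_sum.
rewrite cardT size_enum_ord mulnS; set X := (\sum_(i < d) _)%N => lX; lia.
Qed.

Lemma dvdp_det d (M : 'M[{poly F}]_d) (c : 'I_d -> {poly F}) :
  (forall i j, c i %| M i j) -> \prod_i c i %| \det M.
Proof.
move=> cM; rewrite /determinant; apply: (big_ind (fun p => _ %| p)) => [||s _].
- exact: dvdp0.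
- by move=> *; apply: dvdp_add.
apply: dvdp_mull; apply: (big_ind2 (fun p q => p %| q)) => //.
by move=> *; apply: dvdp_mul.
Qed.

(** Complete a row base of [D] to an invertible constant matrix: multiplying [M] by it scales the
    determinant by a nonzero constant and makes [\rank D] rows divisible by [g]. *)
Lemma dvdp_det_rank d r (M : 'M[{poly F}]_d) (D : 'M[F]_(r, d)) g :
  (forall i j, g %| (map_mx polyC D *m M) i j) -> g ^+ \rank D %| \det M.
Proof.
move=> gDM; pose E := row_ebase D.
have unitE : \det (map_mx polyC E) != 0.
  by rewrite det_map_mx polyC_eq0 -unitfE -unitmxE row_ebase_unit.
have -> : (g ^+ \rank D %| \det M)
        = (g ^+ \rank D %| \det (map_mx polyC E *m M)).
  rewrite det_mulmx det_map_mx mul_polyC dvdpZr //.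
  by move: unitE; rewrite det_map_mx polyC_eq0.
have -> : g ^+ \rank D = \prod_(i < d) (if (i < \rank D)%N then g else 1).
  rewrite -big_mkcond /= (big_ord_narrow (rank_leq_col D)).
  by rewrite prodr_const card_ord.
apply: dvdp_det => i j; case: ifP => [iD|_]; last exact: dvd1p.
have iD' : (i < r)%N := leq_trans iD (rank_leq_row D).
have -> : (map_mx polyC E *m M) i j = (map_mx polyC (invmx (col_ebase D))
    *m (map_mx polyC D *m M)) (Ordinal iD') j.
  rewrite mulmxA -map_mxM -{2}[D]mulmx_ebase -mulmxA mulKmx ?col_ebase_unit //.
  have pidE l : (map_mx polyC (pid_mx (\rank D) : 'M_(r, d))) (Ordinal iD') l
      = (l == i)%:R.
    by rewrite !mxE /= iD andbT eq_sym rmorph_nat.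
  rewrite map_mxM -mulmxA [RHS]mxE (bigD1 i) //= pidE eqxx mul1r.
  by rewrite big1 ?addr0 // => l /negPf li; rewrite pidE li mul0r.
rewrite mxE; apply: (big_ind (fun p => g %| p)) => [||l _].
- exact: dvdp0.
- by move=> *; apply: dvdp_add.
exact: dvdp_mull.
Qed.

Lemma rV_max_support k (u : 'rV[F]_k) : u != 0 ->
  exists2 n : 'I_k, u 0 n != 0 & forall j : 'I_k, (n < j)%N -> u 0 j = 0.
Proof.
case/rV0Pn => n0 un0.
case: (@arg_maxnP _ n0 (fun n : 'I_k => u 0 n != 0) val un0) => n un maxn.
exists n => // j nj; apply/eqP; apply: contraLR nj => uj.
by rewrite -leqNgt; apply: maxn.
Qed.

(* Otherwise there is a nonzero operator sum_i v_i(X) (X d/dX)^i of order < d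
   killing the row space of A. Its leading part in X acts on X^n as Q(n), with
   deg Q < d, so every vector of the row space has its degree among the fewer
   than d roots of Q; hence the coefficients at those roots determine it, which
   contradicts rank A = d. *)
Lemma det_wronskian_neq0 k d (A : 'M[F]_(d, k)) :
  {in [pred i | (i < k)%N] &, injective (fun i : nat => i%:R : F)} ->
  row_free A -> \det (wronskian d A) != 0.
Proof.
move=> inj_nat freeA; apply/negP; rewrite -det_tr => /det0P[v v0 vW].
have annihilates (c : 'rV_d) : \sum_(n < k)
    ((c *m A) 0 n)%:P * ('X^n * \sum_(i < d) (n%:R ^+ i)%:P * v 0 i) = 0.
  have := congr1 (fun M => (map_mx polyC c *m M^T) 0 0) vW.
  rewrite trmx_mul trmxK trmx0 mulmx0 [RHS]mxE /wronskian !mulmxA -map_mxM.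
  rewrite -mulmxA mxE; apply: etrans; apply: eq_bigr => n _.
  rewrite [in RHS]mxE; congr (_ * _); rewrite mulr_sumr mxE.
  by apply: eq_bigr => i _; rewrite !mxE mulrA (mulrC 'X^n).
have /rV0Pn[i0 vi0] := v0.
case: (@arg_maxnP _ i0 xpredT (fun i => size (v 0 i)) isT) => i1 _ maxv.
(* The largest degree in X among the [v 0 i], so that [Q] below is nonzero. *)
pose m := (size (v 0 i1)).-1.
have vi1 : v 0 i1 != 0.
  by rewrite -size_poly_gt0 (leq_trans _ (maxv i0 isT)) // size_poly_gt0.
have szv i : (size (v 0%R i) <= m.+1)%N.
  by rewrite /m prednK ?size_poly_gt0 //; apply: maxv.
pose Q := \poly_(i < d) (if insub i is Some j then (v 0 j)`_m else 0).
have Q0 : Q != 0.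
  apply/negP => /eqP /polyP /(_ (val i1)); rewrite coef0 coef_poly ltn_ord valK.
  by move/eqP; rewrite -lead_coefE lead_coef_eq0 (negPf vi1).
pose Z := [set n : 'I_k | root Q n%:R].
(* Indices below [k] stay distinct in [F], so [Z] injects into the roots of [Q]. *)
have ltZ : (#|Z| < d)%N.
  have := @max_poly_roots _ Q [seq (val n)%:R | n in Z] Q0 _ _.
  rewrite size_map -cardE => ltQ; apply: leq_trans (ltQ _ _) (size_poly _ _).
    by apply/allP => _ /mapP[n nZ ->]; move: nZ; rewrite mem_enum inE.
  rewrite map_inj_in_uniq ?enum_uniq // => n n' _ _ /inj_nat E.
  by apply/val_inj/E; rewrite inE /= ltn_ord.
have [c c0 cZ] : exists2 c : 'rV_d, c != 0
    & c *m colsub (fun z : 'I_#|Z| => enum_val z) A = 0.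
  set M := colsub _ _.
  have: kermx M != 0.
    by rewrite kermx_eq0 -row_leq_rank -ltnNge (leq_ltn_trans (rank_leq_col _)).
  by case/rowV0Pn => c /sub_kermxP; exists c.
have u0 : c *m A != 0.
  by apply: contra c0 => /eqP E; apply/eqP/(row_free_inj freeA); rewrite mul0mx.
have [n un maxn] := rV_max_support u0.
have nZ : ~~ root Q n%:R.
  apply: contra un => nroot; have nZ : n \in Z by rewrite inE.
  have /rowP/(_ (enum_rank_in nZ n)) := cZ; rewrite !mxE => E.
  rewrite -[X in _ == X]E; apply/eqP/eq_bigr => l _.
  by rewrite mxE enum_rankK_in.
(* In degree [n + m] only the top index [n] contributes, giving [(c *m A) 0 n] times Q(n). *)
have := congr1 (fun p : {poly F} => p`_(n + m)) (annihilates c).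
rewrite /= coef0 coef_sum.
rewrite (bigD1 n) //= [X in _ + X]big1 => [|j jn]; last first.
  rewrite coefCM coefXnM; have [nj|jn'] := ltnP n j.
    by rewrite maxn // mul0r.
  rewrite ltnNge (leq_trans jn') ?leq_addr //= nth_default ?mulr0 //.
  rewrite (leq_trans (size_sum _ _ _)) //; apply/bigmax_leqP => i _.
  rewrite mul_polyC (leq_trans (size_scale_leq _ _)) //.
  rewrite (leq_trans (szv i)) // ltn_subRL; have : j != n :> nat by []; lia.
rewrite addr0 coefCM coefXnM ltnNge leq_addr /= addKn coef_sum.
move/eqP; rewrite mulf_eq0 (negPf un) /=; apply/negP.
move: nZ; rewrite /root horner_poly; apply: contra => /eqP E.
rewrite -[X in _ == X]E.
by apply/eqP/eq_bigr => i _; rewrite coefCM valK mulrC.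
Qed.

Lemma dvdp_prod_coprime (J : finType) (p : {poly F}) (h : J -> {poly F}) :
  (forall i j, i != j -> coprimep (h i) (h j)) -> (forall j, h j %| p) ->
  \prod_j h j %| p.
Proof.
move=> cop dvd; elim: (index_enum J) (index_enum_uniq J) => [|j r IHr] /=.
  by rewrite big_nil dvd1p.
case/andP=> jr /IHr dvdr; rewrite big_cons Gauss_dvdp ?dvd ?dvdr //.
elim: r jr {IHr dvdr} => [|i r IHr]; first by rewrite big_nil coprimep1.
rewrite inE negb_or big_cons coprimepMr => /andP[ji /IHr ->].
by rewrite cop.
Qed.

(** Take the Wronskian of a basis of [U], with [d = \rank U]. Fewer than [d] Euler steps leave order
    at least [s - d + 1] on [W j :&: U], and factors at distinct points are coprime; compare with
    the degree bound [d * k]. *)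
Lemma sum_rank_vanishing (J : finType) (alpha : J -> F) k s
    (W : J -> 'M[F]_k.+1) (U : 'M[F]_k.+1) :
  {in [pred i | (i < k.+1)%N] &, injective (fun i : nat => i%:R : F)} ->
  injective alpha ->
  (forall j (v : 'rV_k.+1), (v <= W j)%MS ->
     ('X - (alpha j)%:P) ^+ s %| rVpoly v) ->
  (\rank U <= s)%N ->
  ((s - \rank U).+1 * \sum_j \rank (W j :&: U)%MS <= \rank U * k)%N.
Proof.
move=> inj_nat inj_alpha vanish rU.
pose A := row_base U; set d := \rank U.
have freeA : row_free A by apply: row_base_free.
have det0 := det_wronskian_neq0 inj_nat freeA.
have szdet : (size (\det (wronskian d A)) <= (d * k).+1)%N.
  apply: size_det_leq => b i; rewrite wronskianE.
  by rewrite (leq_trans (size_euler_iter _ _)) // size_poly.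
have dvd j : (('X - (alpha j)%:P) ^+ (s - d).+1) ^+ \rank (W j :&: U)%MS
    %| \det (wronskian d A).
  have /submxP[D DE] : (W j :&: U <= A)%MS by rewrite eq_row_base capmxSr.
  rewrite DE (mxrankMfree _ freeA); apply: dvdp_det_rank => b i.
  rewrite /wronskian mulmxA -map_mxM -DE -/(wronskian d _) wronskianE.
  apply: dvdp_euler_iter; apply: dvdp_trans (dvdp_exp2l _ _) (vanish j _ _).
    by have := ltn_ord i; rewrite -/d in rU; lia.
  by rewrite (submx_trans (row_sub _ _)) ?capmxSl.
have cop i j : i != j -> coprimep
    ((('X - (alpha i)%:P) ^+ (s - d).+1) ^+ \rank (W i :&: U)%MS)
    ((('X - (alpha j)%:P) ^+ (s - d).+1) ^+ \rank (W j :&: U)%MS).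
  move=> ij; do 2![apply/coprimep_expl/coprimep_expr].
  by apply: coprimep_XsubC2; rewrite subr_eq0 (inj_eq inj_alpha) eq_sym.
have := dvdp_leq det0 (dvdp_prod_coprime cop dvd).
rewrite size_prod => [|j _]; last by rewrite !expf_neq0 // polyXsubC_eq0.
under eq_bigr => j _ do rewrite -exprM size_exp_XsubC -add1n.
rewrite big_split /= sum1_card -addnS addKn -big_distrr /= => le_det.
by have := leq_trans le_det szdet.
Qed.
End Wronskian.

(** * Hasse derivatives and agreement of polynomials *)

Lemma dvdp_nderivn (F : fieldType) (f : {poly F}) (a : F) s :
  (forall i, (i < s)%N -> f^`N(i).[a] = 0) -> ('X - a%:P) ^+ s %| f.
Proof.
move=> fa0; have -> : f = (f^:P).[a%:P + ('X - a%:P)].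
  by rewrite addrC subrK -/(comp_poly _ _) comp_polyXr.
rewrite nderiv_taylor; last exact: mulrC.
apply: (big_ind (fun p => _ %| p)) => [||i _]; first exact: dvdp0.
  by move=> *; apply: dvdp_add.
rewrite nderivn_map horner_map /=; have [/fa0->|si] := ltnP i s.
  by rewrite mul0r dvdp0.
by rewrite dvdp_mull // dvdp_exp2l.
Qed.

(** Its left kernel is the space of polynomials of degree below [k] vanishing to order [s] at
    [a]. *)
Definition hasse_mx (F : fieldType) (a : F) k s : 'M[F]_(k, s) :=
  \matrix_(m, i) ('X^m)^`N(i).[a].

Lemma mul_hasse_mx (F : fieldType) (a : F) k s (v : 'rV_k) i :
  (v *m hasse_mx a k s) 0 i = (rVpoly v)^`N(i).[a].
Proof.
have -> : rVpoly v = \sum_m v 0 m *: 'X^m.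
  rewrite [v in LHS]row_sum_delta linear_sum; apply: eq_bigr => m _.
  by rewrite linearZ /= rVpoly_delta.
rewrite mxE linear_sum horner_sum /=; apply: eq_bigr => m _.
by rewrite mxE nderivnZ hornerZ.
Qed.

(** The flat inequality over the zero subspace with unit weights. Here [k] bounds the degree itself,
    hence the numerator of [tau]. *)
Lemma sum_agreement_leq (F : finFieldType) (J : finType) (alpha : J -> F)
    L k s (f : 'I_L.+1 -> 'rV[F]_k.+1) (e : J -> {set 'I_L.+1}) :
  {in [pred i | (i < k.+1)%N] &, injective (fun i : nat => i%:R : F)} ->
  injective alpha -> injective f -> (L <= s)%N ->
  (forall j, {in e j &, forall a b i, (i < s)%N ->
     (rVpoly (f a - f b))^`N(i).[alpha j] = 0}) ->
  ((s - L).+1 * \sum_j #|e j|.-1 <= L * k)%N.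
Proof.
move=> inj_nat inj_alpha inj_f Ls agree.
pose W j := kermx (hasse_mx (alpha j) k.+1 s).
(* Differences to one base point span all differences, so the dimension is at most [L]. *)
pose V := <<\matrix_(i < L) (f (lift ord0 i) - f ord0)>>%MS.
have rV : (\rank V <= L)%N by rewrite genmxE rank_leq_row.
have V0 a : (f a - f ord0 <= V)%MS.
  have [->|[i ->]] : a = ord0 \/ exists i, a = lift ord0 i.
    by case: (unliftP ord0 a) => [i|] ->; [right; exists i | left].
    by rewrite subrr sub0mx.
  by rewrite genmxE; apply: (eq_row_sub i); rewrite rowK.
pose tau : rat := k%:R / (s - L).+1%:R.
have tau0 : 0 <= tau by rewrite divr_ge0.
have cfg : flat_config f tau 0 V [set: 'I_L.+1] e W (fun=> 1).
  split=> //.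
  - exact: sub0mx.
  - by move=> a b _ _ ab; rewrite submx0 subr_eq0 (inj_eq inj_f).
  - move=> a b _ _; apply: (sub_diff_trans (V0 a)).
    by rewrite sub_diff_sym.
  - by move=> j; apply: sub0mx.
  - move=> j a b ae be; apply/sub_kermxP/rowP => i.
    by rewrite mul_hasse_mx mxE agree.
  - move=> U _ UV; rewrite mxrank0 subr0.
    under eq_bigr => j _ do rewrite /= mul1r /excess mxrank0 subr0.
    have rU : (\rank U <= L)%N := leq_trans (mxrankS UV) rV.
    have := @sum_rank_vanishing F J alpha k s W U inj_nat inj_alpha _ _.
    move=> /(_ _ (leq_trans rU Ls)) H.
    rewrite -natr_sum /tau mulrAC ler_pdivlMr ?ltr0n // -!natrM ler_nat.
    rewrite mulnC (mulnC k); apply: leq_trans (H _).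
      by rewrite leq_mul2r ltnS leq_sub2l // orbT.
    move=> j v /sub_kermxP vW; apply: dvdp_nderivn => i si.
    by rewrite -(mul_hasse_mx (alpha j) v (Ordinal si)) vW mxE.
have := flat_config_bound tau0 cfg; rewrite /flat_bound.
have -> : \sum_j 1 * #|e j|.-1%:R = (\sum_j #|e j|.-1)%:R :> rat.
  by rewrite natr_sum; apply: eq_bigr => j _; rewrite mul1r.
rewrite cardsT card_ord /tau mulrAC ler_pdivlMr ?ltr0n //.
by rewrite -!natrM ler_nat mulnC (mulnC k).
Qed.

(** * Codewords, distances and the decoding radius *)

Lemma mult_encodeE (F : finFieldType) n s (alpha : 'I_n -> F)
    (f : {poly F}) j i :
  mult_encode s alpha f j 0 i = f^`N(i).[alpha j].
Proof.
rewrite -hasseE /mult_encode.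
by rewrite (ffunE (fun l => \row_(m < s) (hasse m f).[alpha l]) j) mxE.
Qed.

Lemma mult_encode_eq (F : finFieldType) n s (alpha : 'I_n -> F)
    (f g : {poly F}) j i :
  mult_encode s alpha f j = mult_encode s alpha g j -> (i < s)%N ->
  (f - g)^`N(i).[alpha j] = 0.
Proof.
move=> E si; rewrite nderivnB hornerD hornerN.
have Ei := congr1 (fun r : 'rV_s => r 0 (Ordinal si)) E.
have /= -> := etrans (esym (mult_encodeE alpha f j (Ordinal si)))
  (etrans Ei (mult_encodeE alpha g j (Ordinal si))).
by rewrite subrr.
Qed.

Lemma list_decodable_avg_radius n (Sigma : finType) (rho : rat) L
    (C : {set {ffun 'I_n -> Sigma}}) :
  avg_radius_list_decodable rho L C -> list_decodable rho L C.
Proof.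
move=> avg y; rewrite leqNgt; apply/negP => ltL; apply: avg.
pose x (i : 'I_L.+1) := enum_val (widen_ord ltL i).
exists y, x; split=> [i j /enum_val_inj /(congr1 val) /= /val_inj //|i|].
  by have := enum_valP (widen_ord ltL i); rewrite inE => /andP[].
rewrite ler_pdivrMr ?ltr0n //.
have -> : rho * L.+1%:R = \sum_(i < L.+1) rho.
  by rewrite sumr_const card_ord mulr_natr.
apply: ler_sum => i _.
by have := enum_valP (widen_ord ltL i); rewrite inE => /andP[].
Qed.

Lemma sum_agree_differ n (Sigma : finType) (T : finType)
    (x : T -> {ffun 'I_n -> Sigma}) (y : {ffun 'I_n -> Sigma}) :
  (\sum_i #|[set j | x i j != y j]| + \sum_j #|[set i | x i j == y j]|
   = #|T| * n)%N.
Proof.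
have -> : (\sum_j #|[set i | x i j == y j]| =
           \sum_i #|[set j | x i j == y j]|)%N.
  under eq_bigr do rewrite -sum1dep_card big_mkcond.
  rewrite exchange_big; apply: eq_bigr => i _.
  by rewrite -sum1dep_card -big_mkcond.
rewrite -big_split /= -sum_nat_const; apply: eq_bigr => i _.
rewrite -[RHS]card_ord -(cardsC [set j | x i j == y j]) addnC; congr (_ + _)%N.
by apply: eq_card => j; rewrite !inE.
Qed.

Unset Implicit Arguments.

Theorem theorem1p5 (p : nat) (p_prime : prime p) (s n L k : nat)
    (s_ge1 : (1 <= s)%N) (n_ge1 : (1 <= n)%N) (L_ge1 : (1 <= L)%N)
    (L_le_s : (L <= s)%N) (k_range : (1 <= k <= n)%N)
    (alpha : 'I_n -> 'F_p) (alpha_inj : injective alpha) :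
  let R : rat := mult_rate n k s in
  let rho : rat :=
    L%:R / (L%:R + 1) * (1 - s%:R * R / (s%:R - L%:R + 1)) in
  list_decodable rho L (mult_code k s alpha) /\
  avg_radius_list_decodable rho L (mult_code k s alpha).
Proof.
move=> R rho.
suff avg : avg_radius_list_decodable rho L (mult_code k s alpha).
  by split=> //; apply: list_decodable_avg_radius.
case=> y [x [inj_x xC le_rho]].
(* As [k] is positive it becomes [k.+1]; from here on [k] is the degree bound. *)
case: k k_range @R @rho xC le_rho => [//|k] /andP[_ kn] R rho xC le_rho.
(* Distinct points force [n <= p], so the integers up to [k] are distinct modulo [p]. *)
have np : (n <= p)%N.
  by have := leq_card alpha alpha_inj; rewrite card_ord card_Fp.
have inj_nat :
    {in [pred i | (i < k.+1)%N] &, injective (fun i : nat => i%:R : 'F_p)}.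
  move=> i j; rewrite !inE => ik jk /(congr1 val) /=.
  by rewrite !val_Fp_nat // !modn_small // (leq_trans _ np) // (leq_trans _ kn).
have /fin_all_exists2[f szf fx] i : exists2 f : {poly 'F_p},
    (size f <= k.+1)%N & x i = mult_encode s alpha f by exact/mult_codeP.
pose g i : 'rV_k.+1 := poly_rV (f i).
have gK i : rVpoly (g i) = f i by rewrite poly_rV_K.
have inj_g : injective g.
  by move=> a b ab; apply: inj_x; rewrite !fx -!gK ab.
pose e j := [set i | x i j == y j].
have agree j : {in e j &, forall a b i, (i < s)%N ->
    (rVpoly (g a - g b))^`N(i).[alpha j] = 0}.
  move=> a b; rewrite !inE => /eqP <- /eqP.
  rewrite (fx a) (fx b) => E i si; rewrite linearB /= !gK.
  exact: (mult_encode_eq (esym E)).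
have := sum_agreement_leq inj_nat alpha_inj inj_g L_le_s agree.
set P := (\sum_j _)%N => leP.
have := sum_agree_differ x y; rewrite card_ord.
set D := (\sum_i _)%N; set E := (\sum_j _)%N => DE.
(* This covers empty [e j] too, as [0.-1 = 0]. *)
have leE : (E <= n + P)%N.
  rewrite -[n in X in (_ <= X)%N]card_ord -sum1_card -big_split /=.
  by apply: leq_sum => j _; rewrite add1n leqSpred.
(* Combine [D + E = (L + 1) n], [E <= n + P] and the bound on [P]; it is strict as [L >= 1] gives
   [L k < L (k + 1)]. *)
have : ((s - L).+1 * L * n < (s - L).+1 * D + L * k.+1)%N.
  move: DE leE leP L_ge1; clear; set M := (s - L).+1; nia.
rewrite ltnNge => /negP; apply.
(* With denominators cleared, the average-radius hypothesis is the reverse inequality. *)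
move: le_rho; rewrite /delta -mulr_suml -natr_sum -/D.
rewrite /rho /R /mult_rate.
have s0 : s%:R != 0 :> rat by rewrite pnatr_eq0; lia.
have n0 : n%:R != 0 :> rat by rewrite pnatr_eq0; lia.
have -> : s%:R - L%:R + 1 = (s - L).+1%:R :> rat.
  by rewrite -natr1 natrB.
rewrite natr1.
set M := (s - L).+1.
have M0 : 0 < M%:R :> rat by rewrite ltr0n.
have L0 : 0 < L.+1%:R :> rat by rewrite ltr0n.
have n1 : 0 < n%:R :> rat by rewrite ltr0n.
rewrite ler_pdivrMr // mulrAC divfK ?gt_eqF // ler_pdivrMr //.
have -> : L%:R * (1 - s%:R * (k.+1%:R / (s%:R * n%:R)) / M%:R) * n%:R =
  (L%:R * n%:R * M%:R - L%:R * k.+1%:R) / M%:R :> rat.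
  by field; rewrite s0 n0 gt_eqF.
rewrite ler_pdivlMr // lerBrDr -!natrM -natrD ler_nat; lia.
Qed.
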